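(* Let $\mathbb{J}=\mathrm{diag}[J_1,\dots,J_n]$ with $J_j>0$ for all $j$, and consider the energy-momentum map $(P,H):T^*\mathrm{S}^{n-1}\to\mathbb{R}^2$ with $P=\|p\|^2$ and $H$ the energy of the reduced Veselova system. (i) The critical points of $(P,H)$ with $p\ne0$ occur exactly at the steady rotations, i.e. at those points $(q,p)$ with $p\neq 0$ lying on (projections to $T^*\mathrm{S}^{n-1}$ of) steady rotation solutions. (ii) The critical values of $(P,H)$ are the rays $L_{ij}$ in the closed positive quadrant given by $P=2(J_i+J_j)H$, for $i<j$.
   Context: Let $n\ge 2$. $T^*\mathrm{S}^{n-1}=\{(q,p)\in\mathbb{R}^n\times\mathbb{R}^n:\|q\|=1,\ q\cdot p=0\}$. The reduced Veselova system on it is $$\dot q=C\left[p-\frac{p\cdot Cq}{q\cdot Cq}q\right],\quad \dot p=-2H(q,p)q,\quad C=C(q)=(\mathbb{J}+(q\cdot\mathbb{J}q)\mathrm{Id}_n)^{-1},$$ $$H(q,p)=\frac12\left(p\cdot Cp-\frac{(p\cdot Cq)^2}{q\cdot Cq}\right).$$ The angular velocity along a solution is $\Omega=q\wedge\dot q=q\dot q^T-\dot q q^T$. A (non-trivial) steady rotation is a solution along which $\Omega$ is constant and nonzero; on $T^*\mathrm{S}^{n-1}$ these are periodic solutions where $q$ and $p$ rotate uniformly in a principal plane, i.e. a 2-dimensional $\mathbb{J}$-invariant subspace of $\mathbb{R}^n$. A critical point of $(P,H)$ is a point where $dP$ and $dH$ (on $T^*\mathrm{S}^{n-1}$) are linearly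 dependent; a critical value is the image of a critical point. The eigenvalues $J_j$ are not assumed distinct; only $i\ne j$ is required in (ii). *)

(* Defs.v *)
From mathcomp Require Export all_boot all_order all_algebra.
From mathcomp Require Export all_classical all_reals all_analysis.
Import Order.TTheory GRing.Theory Num.Theory.
Import numFieldNormedType.Exports.
Set Implicit Arguments.
Unset Strict Implicit.
Unset Printing Implicit Defensive.
Local Open Scope classical_set_scope.
Local Open Scope ring_scope.

Section Veselova.
Context {R : realType} {n : nat}.
Implicit Types (q p x y : 'cV[R]_n) (z w : 'cV[R]_n * 'cV[R]_n).

Definition dot x y : R := \sum_i x i 0 * y i 0.

(* The norm `|x| that the library puts on matrices is the sup norm. *)
Definition enorm x : R := Num.sqrt (dot x x).

Definition wedge x y : 'M[R]_n := x *m y^T - y *m x^T.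

Definition cotangent_sphere : set ('cV[R]_n * 'cV[R]_n) :=
  [set z | enorm z.1 = 1 /\ dot z.1 z.2 = 0].

(* Kernel at z of the differentials of the two defining equations
   q . q = 1 and q . p = 0 of the cotangent bundle of the sphere. *)
Definition tangent_space z : set ('cV[R]_n * 'cV[R]_n) :=
  [set w | dot z.1 w.1 = 0 /\ dot w.1 z.2 + dot z.1 w.2 = 0].

Variable J : 'rV[R]_n.

Definition JJ : 'M[R]_n := diag_mx J.

Definition Cmx q : 'M[R]_n := invmx (JJ + (dot q (JJ *m q))%:M).

Definition Pfun z : R := enorm z.2 ^+ 2.

Definition Hfun z : R :=
  let q := z.1 in let p := z.2 in let C := Cmx q in
  2^-1 * (dot p (C *m p) - dot p (C *m q) ^+ 2 / dot q (C *m q)).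

Definition qfield z : 'cV[R]_n :=
  let q := z.1 in let p := z.2 in let C := Cmx q in
  C *m (p - (dot p (C *m q) / dot q (C *m q)) *: q).

Definition pfield z : 'cV[R]_n := - (2 * Hfun z) *: z.1.

(* Solutions are taken on the whole time axis: the flow is complete, because
   it preserves the compact sets given by a fixed value of P. *)
Definition is_solution (q p : R -> 'cV[R]_n) : Prop :=
  forall t : R,
    [/\ cotangent_sphere (q t, p t),
        is_derive t 1 q (qfield (q t, p t)) &
        is_derive t 1 p (pfield (q t, p t))].

Definition angular_velocity (q : R -> 'cV[R]_n) (t : R) : 'M[R]_n :=
  wedge (q t) (derive1 q t).

Definition is_steady_rotation (q p : R -> 'cV[R]_n) : Prop :=
  is_solution q p /\
  exists Omega : 'M[R]_n,
    Omega != 0 /\ forall t : R, angular_velocity q t = Omega.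

Definition steady_rotation_points : set ('cV[R]_n * 'cV[R]_n) :=
  [set z | exists q p : R -> 'cV[R]_n,
     is_steady_rotation q p /\ exists t : R, z = (q t, p t)].

(* The differential of a function on the submanifold cotangent_sphere is the
   restriction to the tangent space of the differential of its extension to
   the ambient space given by the same formula. *)
Definition critical_points : set ('cV[R]_n * 'cV[R]_n) :=
  [set z | cotangent_sphere z /\
     exists ab : R * R, ab != 0 /\
       forall w, tangent_space z w ->
         ab.1 * 'd Pfun z w + ab.2 * 'd Hfun z w = 0].

Definition critical_values : set (R * R) :=
  [set (Pfun z, Hfun z) | z in critical_points].

Definition ray (i j : 'I_n) : set (R * R) :=
  [set PH | [/\ 0 <= PH.1, 0 <= PH.2 &
              PH.1 = 2 * (J 0 i + J 0 j) * PH.2]].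

End Veselova.

(* Main.v *)
From HB Require Import structures.
Require Import Defs.
From mathcomp Require Import ring lra.
Set Implicit Arguments.
Unset Strict Implicit.
Unset Printing Implicit Defensive.
Import Order.TTheory GRing.Theory Num.Theory.
Import numFieldNormedType.Exports.
Local Open Scope classical_set_scope.
Local Open Scope ring_scope.

(** Both halves of the statement go through one algebraic condition on a point
    (q, p) with p nonzero: the plane spanned by q and p is invariant under JJ
    ([principal_plane], which also records the trace tau of JJ on the plane).

    Write w = [qfield J (q, p)] and s = q . JJ q.  The velocity w is
    characterised by w . q = 0 and (JJ + s) w = p - mu q, where mu is a Lagrange
    multiplier ([inertia_qfield], [qfield_unique]), and p . w = 2 H.  Since mu
    minimises (p - mu q) . C (p - mu q), whose minimum is 2 H, differentiating H
    does not see the variation of mu, and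
      dH (dq, dp) = w . dp - mu (w . dq) - (JJ q . dq) (w . w)
    ([diff_Hfun]).

    Critical points are the points of principal planes.  As dP (dq, dp) =
    2 p . dp does not vanish on the tangent space when p is nonzero, criticality
    says that dH is a multiple of dP there.  Tangent vectors (0, v) and (v, 0)
    with v orthogonal to q and p then give that w is a multiple of p and that
    JJ q lies in the plane; the equation for w puts JJ p there as well.
    Conversely, on a principal plane w = p / tau, and the formula for dH
    reduces to dH = dP / (2 tau) on the tangent space.

    Steady rotations stay in principal planes.  If Omega is constant, then
    q' = - Omega q, so a vector v orthogonal to q and q' at one time is
    orthogonal to them at all times.  For such v, v . p = JJ v . q', while
    (v . p)' = - 2 H v . q = 0; as q'' is a nonzero multiple of q, this gives
    JJ v . q = 0 at all times, hence JJ v . q' = 0 as well: the plane is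
    invariant, and it contains p.  Conversely, on a principal plane w = p / tau
    makes the uniform rotation of (q, p) in the plane a solution
    ([principal_plane_steady]).

    Critical values.  On a principal plane 2 H = p . w = P / tau.  The minors
    q_i p_j - p_i q_j are the coordinates of the bivector of the plane, on which
    JJ acts as a derivation both by the scalar tau and, coordinatewise, by
    J_i + J_j; so tau = J_i + J_j for any nonzero minor
    ([principal_plane_trace]).  Each ray is attained on a coordinate plane. *)

(** * Euclidean geometry of column vectors *)

Section DotProduct.
Context {R : realType} {n : nat}.
Implicit Types (x y u v : 'cV[R]_n) (a : R).

Lemma dotC x y : dot x y = dot y x.
Proof. by apply: eq_bigr => i _; rewrite mulrC. Qed.

Lemma dotDl x y v : dot (x + y) v = dot x v + dot y v.
Proof. by rewrite -big_split; apply: eq_bigr => i _; rewrite mxE mulrDl. Qed.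

Lemma dotZl a x v : dot (a *: x) v = a * dot x v.
Proof. by rewrite mulr_sumr; apply: eq_bigr => i _; rewrite mxE mulrA. Qed.

Lemma dotNl x v : dot (- x) v = - dot x v.
Proof. by rewrite -scaleN1r dotZl mulN1r. Qed.

Lemma dotDr x y v : dot v (x + y) = dot v x + dot v y.
Proof. by rewrite dotC dotDl !(dotC v). Qed.

Lemma dotZr a x v : dot v (a *: x) = a * dot v x.
Proof. by rewrite dotC dotZl (dotC v). Qed.

Lemma dotNr x v : dot v (- x) = - dot v x.
Proof. by rewrite dotC dotNl (dotC v). Qed.

Lemma dot0r x : dot x 0 = 0.
Proof. by rewrite -(scale0r x) dotZr mul0r. Qed.

Definition dotE := (dotDl, dotDr, dotNl, dotNr, dotZl, dotZr).

Lemma dot_ge0 x : 0 <= dot x x.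
Proof. by apply: sumr_ge0 => i _; rewrite -expr2 sqr_ge0. Qed.

Lemma dot_eq0 x : (dot x x == 0) = (x == 0).
Proof.
apply/eqP/eqP => [x0|->]; last exact: dot0r.
apply/matrixP => i j; rewrite ord1 mxE; apply/eqP.
rewrite -sqrf_eq0 expr2; apply/eqP; apply: (psumr_eq0P _ x0) => // k _.
by rewrite -expr2 sqr_ge0.
Qed.

Lemma dot_gt0 x : x != 0 -> 0 < dot x x.
Proof. by rewrite lt_def dot_eq0 dot_ge0 andbT. Qed.

Lemma enorm_sqr x : enorm x ^+ 2 = dot x x.
Proof. by rewrite sqr_sqrtr ?dot_ge0. Qed.

Lemma dot_mulmx (M : 'M[R]_n) x y : dot x (M *m y) = dot (M^T *m x) y.
Proof.
under [LHS]eq_bigr do rewrite mxE mulr_sumr.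
rewrite exchange_big; apply: eq_bigr => j _.
rewrite mxE mulr_suml; apply: eq_bigr => i _; rewrite mxE; ring.
Qed.

(** Double orthogonal complement, for the plane spanned by [u] and [v]. *)
Lemma in_plane x u v : dot u u = 1 -> dot u v = 0 -> v != 0 ->
  (forall w, dot u w = 0 -> dot v w = 0 -> dot w x = 0) ->
  x = dot u x *: u + (dot v x / dot v v) *: v.
Proof.
move=> uu uv v0 xP; have vv : dot v v != 0 by rewrite dot_eq0.
have vu : dot v u = 0 by rewrite dotC.
apply/eqP; rewrite -subr_eq0 -dot_eq0; apply/eqP.
move wE : (x - _) => w.
have uw : dot u w = 0 by rewrite -wE !dotE uu uv; field.
have vw : dot v w = 0 by rewrite -wE !dotE vu; field.
by rewrite -{2}wE !dotE (xP w uw vw) !(dotC w) uw vw; field.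
Qed.

(** For orthogonal vectors, the bivector maps each of them to a multiple of the
    other; this is how the angular velocity determines the velocity. *)
Lemma wedge_mul u v x : wedge u v *m x = dot v x *: u - dot u x *: v.
Proof.
have tr (y : 'cV[R]_n) : y^T *m x = (dot y x)%:M.
  rewrite [LHS]mx11_scalar mxE; congr (_%:M).
  by apply: eq_bigr => i _; rewrite mxE.
by rewrite mulmxBl -!mulmxA !tr !mul_mx_scalar.
Qed.

Lemma wedge_mxE u v i j : wedge u v i j = u i 0 * v j 0 - v i 0 * u j 0.
Proof. by rewrite !mxE !big_ord1 !mxE. Qed.

Lemma wedge_tr u v : (wedge u v)^T = - wedge u v.
Proof. by apply/matrixP => i j; rewrite mxE [RHS]mxE !wedge_mxE; ring. Qed.

Lemma wedge_neq0 u v : dot u u = 1 -> dot u v = 0 -> v != 0 -> wedge u v != 0.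
Proof.
move=> uu uv; apply: contraNneq => w0.
have := wedge_mul u v u; rewrite w0 mul0mx uu dotC uv scale0r sub0r scale1r.
by move=> /eqP; rewrite eq_sym oppr_eq0.
Qed.

End DotProduct.

(** * The inertia operator and its inverse *)

Lemma diag_form_gt0 {R : realType} {n : nat} (d : 'rV[R]_n) (x : 'cV[R]_n) :
  (forall i, 0 < d 0 i) -> x != 0 -> 0 < dot x (diag_mx d *m x).
Proof.
move=> d0 x0.
have ge0 i : true -> 0 <= x i 0 * (diag_mx d *m x) i 0.
  by rewrite mul_diag_mx mxE mulrCA mulr_ge0 ?(ltW (d0 i)) // -expr2 sqr_ge0.
rewrite lt_def sumr_ge0 // andbT; apply: contra x0 => /eqP /(psumr_eq0P ge0) xd.
apply/eqP/matrixP => i j; rewrite ord1 mxE; have /eqP := xd i isT.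
by rewrite mul_diag_mx mxE !mulf_eq0 (gt_eqF (d0 i)) orbb => /eqP.
Qed.

Section Matrices.
Context {R : realType} {n : nat} (J : 'rV[R]_n) (hJ : forall j, 0 < J 0 j).
Implicit Types (q x y : 'cV[R]_n).

Lemma JJ_mxE x i : (JJ J *m x) i 0 = J 0 i * x i 0.
Proof. by rewrite mul_diag_mx mxE. Qed.

Lemma JJ_sym x y : dot x (JJ J *m y) = dot y (JJ J *m x).
Proof. by rewrite dot_mulmx tr_diag_mx dotC. Qed.

Lemma JJ_gt0 x : x != 0 -> 0 < dot x (JJ J *m x).
Proof. exact: diag_form_gt0. Qed.

Lemma JJ_ge0 x : 0 <= dot x (JJ J *m x).
Proof.
have [->|/JJ_gt0/ltW//] := eqVneq x 0.
by rewrite mulmx0 dot0r.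
Qed.

Lemma inertia_gt0 q i : 0 < J 0 i + dot q (JJ J *m q).
Proof. by rewrite ltr_pwDl ?JJ_ge0. Qed.

(** Positivity of J makes this valid at every q, on and off the sphere, as is
    needed to differentiate H in the ambient space. *)
Lemma Cmx_diag q :
  Cmx J q = diag_mx (\row_i (J 0 i + dot q (JJ J *m q))^-1).
Proof.
rewrite /Cmx; set A := _ + _; set D := diag_mx _.
have AD : A *m D = 1%:M.
  rewrite /A /JJ mulmxDl mulmx_diag mul_scalar_mx.
  apply/matrixP => i j; rewrite !mxE.
  case: eqP => [->|_]; last by rewrite mulr0 addr0.
  rewrite !mulr1n -mulrDl divff // gt_eqF ?inertia_gt0 //.
by rewrite -[LHS]mulmx1 -AD mulKmx // (mulmx1_unit AD).1.
Qed.

Lemma Cmx_mxE q x i :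
  (Cmx J q *m x) i 0 = x i 0 / (J 0 i + dot q (JJ J *m q)).
Proof. by rewrite Cmx_diag mul_diag_mx !mxE mulrC. Qed.

Lemma Cmx_sym q x y : dot x (Cmx J q *m y) = dot y (Cmx J q *m x).
Proof. by rewrite Cmx_diag dot_mulmx tr_diag_mx dotC. Qed.

Lemma Cmx_gt0 q x : x != 0 -> 0 < dot x (Cmx J q *m x).
Proof.
rewrite Cmx_diag; apply: diag_form_gt0 => i.
by rewrite mxE invr_gt0 inertia_gt0.
Qed.

Lemma Cmx_inertia q x :
  Cmx J q *m (JJ J *m x + dot q (JJ J *m q) *: x) = x.
Proof.
apply/matrixP => i j; rewrite ord1 Cmx_mxE mxE JJ_mxE mxE.
by have := inertia_gt0 q i => /lt0r_neq0 ?; field.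
Qed.

Lemma inertia_Cmx q x :
  JJ J *m (Cmx J q *m x) + dot q (JJ J *m q) *: (Cmx J q *m x) = x.
Proof.
apply/matrixP => i j.
rewrite ord1 [LHS]mxE [X in X + _]JJ_mxE [X in _ + X]mxE Cmx_mxE.
by have := inertia_gt0 q i => /lt0r_neq0 ?; field.
Qed.

End Matrices.

(** * The velocity and principal planes *)

Section Velocity.
Context {R : realType} {n : nat} (J : 'rV[R]_n) (hJ : forall j, 0 < J 0 j).
Implicit Types (q w : 'cV[R]_n) (z : 'cV[R]_n * 'cV[R]_n).

(** The Lagrange multiplier that keeps the velocity tangent to the sphere. *)
Definition multiplier z : R :=
  dot z.2 (Cmx J z.1 *m z.1) / dot z.1 (Cmx J z.1 *m z.1).

Lemma cotangent_sphereP z :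
  cotangent_sphere z <-> dot z.1 z.1 = 1 /\ dot z.1 z.2 = 0.
Proof.
split=> -[h1 h2]; split=> //; first by rewrite -enorm_sqr h1 expr1n.
by rewrite /enorm h1 sqrtr1.
Qed.

Lemma unit_neq0 q : dot q q = 1 -> q != 0.
Proof. by move=> qq; rewrite -dot_eq0 qq oner_eq0. Qed.

Lemma qfieldE z :
  qfield J z = Cmx J z.1 *m z.2 - multiplier z *: (Cmx J z.1 *m z.1).
Proof. by rewrite /qfield mulmxBr -scalemxAr. Qed.

Lemma inertia_qfield z :
  JJ J *m qfield J z + dot z.1 (JJ J *m z.1) *: qfield J z
    = z.2 - multiplier z *: z.1.
Proof. by rewrite /qfield inertia_Cmx. Qed.

Lemma dot_q_qfield z : z.1 != 0 -> dot z.1 (qfield J z) = 0.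
Proof.
move=> /(Cmx_gt0 hJ z.1)/lt0r_neq0 c0.
by rewrite qfieldE !dotE (Cmx_sym hJ) /multiplier; field.
Qed.

Lemma dot_p_qfield z : dot z.2 (qfield J z) = 2 * Hfun J z.
Proof.
rewrite qfieldE !dotE /multiplier /Hfun mulrA divff ?pnatr_eq0 // mul1r.
by rewrite expr2 mulrAC.
Qed.

(** Inverting JJ + s expresses w by m, and q . w = 0 then forces m to be the
    multiplier, because q . C q > 0. *)
Lemma qfield_unique z w m : z.1 != 0 -> dot z.1 w = 0 ->
  JJ J *m w + dot z.1 (JJ J *m z.1) *: w = z.2 - m *: z.1 ->
  qfield J z = w.
Proof.
move=> q0 qw wE; have c0 := lt0r_neq0 (Cmx_gt0 hJ z.1 q0).
have {}wE : w = Cmx J z.1 *m z.2 - m *: (Cmx J z.1 *m z.1).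
  by rewrite scalemxAr -mulmxBr -wE (Cmx_inertia hJ).
suff mE : multiplier z = m by rewrite qfieldE mE -wE.
move: qw; rewrite wE !dotE (Cmx_sym hJ) => /eqP.
by rewrite addr_eq0 opprK => /eqP cm; rewrite /multiplier cm mulfK.
Qed.

(** The four coefficients are the matrix of JJ on the plane of [z.1] and [z.2],
    so that [tau] is the trace of the restriction of JJ. *)
Definition principal_plane z (tau : R) : Prop :=
  exists a b c d : R,
    [/\ JJ J *m z.1 = a *: z.1 + b *: z.2,
        JJ J *m z.2 = c *: z.1 + d *: z.2 & a + d = tau].

(** Orthogonality of q and p and symmetry of JJ leave a single off-diagonal
    coefficient c = p . JJ q; the trace is positive since JJ is positive
    definite. *)
Lemma principal_planeP z tau : cotangent_sphere z -> z.2 != 0 ->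
  principal_plane z tau ->
  exists c : R,
    [/\ 0 < tau,
        JJ J *m z.1 = dot z.1 (JJ J *m z.1) *: z.1 + (c / dot z.2 z.2) *: z.2 &
        JJ J *m z.2 = c *: z.1 + (tau - dot z.1 (JJ J *m z.1)) *: z.2].
Proof.
case: z => q p /cotangent_sphereP/= [qq qp] p0 [a [b [c [d /= [Jq Jp <-]]]]].
have pp := dot_gt0 p0; have pq : dot p q = 0 by rewrite dotC.
have aE : dot q (JJ J *m q) = a by rewrite Jq !dotE qq qp; ring.
have bc : b * dot p p = c.
  have := JJ_sym J p q.
  by rewrite Jq Jp !dotE qq qp pq !mulr0 addr0 add0r mulr1.
have d0 : 0 < d * dot p p.
  by have := JJ_gt0 hJ p0; rewrite Jp !dotE pq mulr0 add0r.
have a0 : 0 < a by rewrite -aE JJ_gt0 ?unit_neq0.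
exists c; split.
- by rewrite addr_gt0 // -(pmulr_lgt0 _ pp).
- by rewrite aE -bc mulfK ?gt_eqF.
- by rewrite aE Jp addrAC subrr add0r.
Qed.

(** Here (JJ + s) p = c q + tau p, so p / tau solves the equation that
    characterises the velocity. *)
Lemma principal_plane_qfield z tau : cotangent_sphere z -> z.2 != 0 ->
  principal_plane z tau -> 0 < tau /\ qfield J z = tau^-1 *: z.2.
Proof.
move=> zS p0 zP; have [c [tau0 Jq Jp]] := principal_planeP zS p0 zP.
have [qq qp] := (cotangent_sphereP z).1 zS.
split=> //; apply: (qfield_unique (m := - (c / tau))).
- exact: unit_neq0.
- by rewrite dotZr qp mulr0.
rewrite -scalemxAr Jp; apply/matrixP => i j; rewrite !mxE.
by field; rewrite gt_eqF.
Qed.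

Lemma principal_plane_PH z tau : cotangent_sphere z -> z.2 != 0 ->
  principal_plane z tau -> 0 < tau /\ Pfun z = 2 * tau * Hfun J z.
Proof.
move=> zS p0 /(principal_plane_qfield zS p0)[tau0 w]; split=> //.
have := dot_p_qfield z; rewrite w dotZr => pw.
rewrite /Pfun enorm_sqr mulrAC -pw mulrAC mulVf ?mul1r // gt_eqF //.
Qed.

(** Compare the two ways in which JJ acts on the bivector of the plane: by the
    trace on the whole bivector, and by J_i + J_j on its (i, j) coordinate. *)
Lemma principal_plane_trace z tau : cotangent_sphere z -> z.2 != 0 ->
  principal_plane z tau ->
  exists i j : 'I_n, (i < j)%N /\ tau = J 0 i + J 0 j.
Proof.
case: z => q p /cotangent_sphereP/= [qq qp] p0 [a [b [c [d /= [Jq Jp <-]]]]].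
(* The derivation property of JJ on the (i, j) minor. *)
have tr i j : (J 0 i + J 0 j) * wedge q p i j = (a + d) * wedge q p i j.
  have E k : (J 0 k * q k 0 = a * q k 0 + b * p k 0) *
             (J 0 k * p k 0 = c * q k 0 + d * p k 0).
    by rewrite -!JJ_mxE Jq Jp !mxE.
  rewrite wedge_mxE.
  have -> : (J 0 i + J 0 j) * (q i 0 * p j 0 - p i 0 * q j 0) =
     (J 0 i * q i 0) * p j 0 - (J 0 i * p i 0) * q j 0
     + q i 0 * (J 0 j * p j 0) - p i 0 * (J 0 j * q j 0) by ring.
  by rewrite !E; ring.
have [i [j Mij]] : exists i j, wedge q p i j != 0.
  apply: contrapT => M0; have /eqP[] := wedge_neq0 qq qp p0.
  apply/matrixP => i j; rewrite [RHS]mxE; apply/eqP/negPn/negP => Mij.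
  by apply: M0; exists i, j.
have trE : a + d = J 0 i + J 0 j by apply: (mulIf Mij); rewrite tr.
have [lij|lji|ij] := ltngtP i j.
- by exists i, j.
- by exists j, i; rewrite lji trE addrC.
by move: Mij; rewrite (val_inj ij) wedge_mxE mulrC subrr eqxx.
Qed.

End Velocity.

(** * Calculus of differentials of real-valued functions *)

Section Differentials.
Context {R : realType} {V : normedModType R}.
Implicit Types (f g df dg : V -> R) (x : V).

Lemma is_diff_mul f g df dg x : is_diff x f df -> is_diff x g dg ->
  is_diff x (fun y => f y * g y) (fun w => f x * dg w + g x * df w).
Proof. by move=> fx gx; exact: is_diffM. Qed.

Lemma is_diff_cst_add (a : R) f df x : is_diff x f df ->
  is_diff x (fun y => a + f y) df.
Proof.
move=> fx; have := is_diffD (is_diff_cst a x) fx.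
by rewrite add0r.
Qed.

Lemma is_diff_sum n (f df : 'I_n -> V -> R) x :
  (forall i, is_diff x (f i) (df i)) ->
  is_diff x (fun y => \sum_i f i y) (fun w => \sum_i df i w).
Proof.
move=> fx; have E (F : 'I_n -> V -> R) : (fun w => \sum_i F i w) = \sum_i F i.
  by apply: funext => w; rewrite fct_sumE.
rewrite !E.
elim/big_ind2 : _ => // [|? ? ? ? ? ?]; first exact: is_diff_cst.
exact: is_diffD.
Qed.

Lemma is_diff_inv f df x : is_diff x f df -> f x != 0 ->
  is_diff x (fun y => (f y)^-1) (fun w => - (f x) ^- 2 * df w).
Proof.
move=> fx f0; apply: DiffDef.
  by apply: differentiableV => //; exact: ex_diff.
by rewrite diffV ?diff_val //; exact: ex_diff.
Qed.

Lemma is_diff_linear (f : V -> R) x :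
  (forall (a : R) u v, f (a *: u + v) = a * f u + f v) -> continuous f ->
  is_diff x f f.
Proof.
move=> f_lin fc.
pose fM := GRing.isLinear.Build R V R *:%R f f_lin.
pose L : {linear V -> R} := HB.pack f fM.
rewrite -[f]/(L : V -> R); apply: DiffDef; first exact: linear_differentiable.
exact: diff_lin.
Qed.

End Differentials.

(** * The differentials of P and H *)

Section DiffH.
Context {R : realType} {n : nat} (J : 'rV[R]_n) (hJ : forall j, 0 < J 0 j).
Local Notation V := ('cV[R]_n * 'cV[R]_n)%type.
Implicit Types (z w : V).

Lemma is_diff_coord1 i z :
  is_diff z (fun x : V => x.1 i 0) (fun w => w.1 i 0).
Proof.
apply: is_diff_linear => [a u v|x]; first by rewrite !mxE.
apply: (@continuous_comp _ _ _ fst (fun M : 'cV[R]_n => M i 0)).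
  exact: cvg_fst.
exact: coord_continuous.
Qed.

Lemma is_diff_coord2 i z :
  is_diff z (fun x : V => x.2 i 0) (fun w => w.2 i 0).
Proof.
apply: is_diff_linear => [a u v|x]; first by rewrite !mxE.
apply: (@continuous_comp _ _ _ snd (fun M : 'cV[R]_n => M i 0)).
  exact: cvg_snd.
exact: coord_continuous.
Qed.

Lemma is_diff_dot (f g df dg : V -> 'cV[R]_n) z :
  (forall i, is_diff z (fun x => f x i 0) (fun w => df w i 0)) ->
  (forall i, is_diff z (fun x => g x i 0) (fun w => dg w i 0)) ->
  is_diff z (fun x => dot (f x) (g x))
    (fun w => dot (f z) (dg w) + dot (df w) (g z)).
Proof.
move=> fz gz; apply: is_diff_eq.
  by apply: is_diff_sum => i; apply: is_diff_mul.
apply: funext => w; rewrite /dot -big_split; apply: eq_bigr => i _.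
by rewrite [df w i 0 * _]mulrC.
Qed.

Lemma diff_Pfun z w : 'd (Pfun : V -> R) z w = 2 * dot z.2 w.2.
Proof.
have -> : Pfun = (fun x : V => dot x.2 x.2).
  by apply: funext => x; rewrite /Pfun enorm_sqr.
have dp i := is_diff_coord2 i z; have dP := is_diff_dot dp dp.
by rewrite diff_val (dotC w.2) mulrDl mul1r.
Qed.

(** C is the inverse of JJ + s, so dC = - ds C C with ds = 2 (JJ q . dq). *)
Lemma is_diff_Cmx (g dg : V -> 'cV[R]_n) i z :
  (forall i, is_diff z (fun x => g x i 0) (fun w => dg w i 0)) ->
  is_diff z (fun x => (Cmx J x.1 *m g x) i 0)
    (fun w => (Cmx J z.1 *m dg w - (2 * dot (JJ J *m z.1) w.1) *:
               (Cmx J z.1 *m (Cmx J z.1 *m g z))) i 0).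
Proof.
move=> gz.
have -> : (fun x : V => (Cmx J x.1 *m g x) i 0) =
          (fun x : V => g x i 0 * (J 0 i + dot x.1 (JJ J *m x.1))^-1).
  by apply: funext => x; rewrite Cmx_mxE.
have JJz k : is_diff z (fun x : V => (JJ J *m x.1) k 0)
                        (fun w => (JJ J *m w.1) k 0).
  have JJE : (fun x : V => (JJ J *m x.1) k 0) = (fun x => J 0 k * x.1 k 0).
    by apply: funext => x; rewrite JJ_mxE.
  by rewrite !JJE; exact: (is_diffZ (J 0 k) (is_diff_coord1 k z)).
have sz := is_diff_dot (fun k => is_diff_coord1 k z) JJz.
have Iz : is_diff z (fun x : V => J 0 i + dot x.1 (JJ J *m x.1))
    (fun w => dot z.1 (JJ J *m w.1) + dot w.1 (JJ J *m z.1)).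
  exact: is_diff_cst_add.
have I0 := lt0r_neq0 (inertia_gt0 hJ z.1 i).
apply: is_diff_eq; first exact: (is_diff_mul (gz i) (is_diff_inv Iz I0)).
apply: funext => w; rewrite [RHS]mxE [X in _ = _ + X]mxE [X in _ = _ - X]mxE.
rewrite !(Cmx_mxE hJ) (JJ_sym J z.1) (dotC w.1).
by field.
Qed.

Lemma is_diff_Cform (f g df dg : V -> 'cV[R]_n) z :
  (forall i, is_diff z (fun x => f x i 0) (fun w => df w i 0)) ->
  (forall i, is_diff z (fun x => g x i 0) (fun w => dg w i 0)) ->
  is_diff z (fun x => dot (f x) (Cmx J x.1 *m g x))
    (fun w => dot (df w) (Cmx J z.1 *m g z) + dot (Cmx J z.1 *m f z) (dg w)
      - 2 * dot (JJ J *m z.1) w.1 *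
        dot (Cmx J z.1 *m f z) (Cmx J z.1 *m g z)).
Proof.
move=> fz gz; apply: is_diff_eq.
  exact: is_diff_dot fz (fun i => is_diff_Cmx i gz).
apply: funext => w; rewrite dotDr dotNr dotZr !(Cmx_sym hJ z.1 (f z)).
by rewrite !(dotC (Cmx J z.1 *m f z)); ring.
Qed.

(** The two quadratic and the one bilinear form in C that enter H combine into
    terms in w = C p - mu C q alone. No term in the differential of mu remains,
    because mu is the minimiser of (p - mu q) . C (p - mu q). *)
Lemma diff_Hfun z w : z.1 != 0 ->
  'd (Hfun J : V -> R) z w =
    dot (qfield J z) w.2 - multiplier J z * dot (qfield J z) w.1
    - dot (JJ J *m z.1) w.1 * dot (qfield J z) (qfield J z).
Proof.
move=> q0; have c0 := lt0r_neq0 (Cmx_gt0 hJ z.1 q0).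
have dq i := is_diff_coord1 i z; have dp i := is_diff_coord2 i z.
have dpp := is_diff_Cform dp dp.
have dpq := is_diff_Cform dp dq.
have dqq := is_diff_Cform dq dq.
have dH := is_diffZ 2^-1 (is_diffB dpp
  (is_diff_mul (is_diff_mul dpq dpq) (is_diff_inv dqq c0))).
have HE : (Hfun J : V -> R) = 2^-1 *:
  ((fun x : V => dot x.2 (Cmx J x.1 *m x.2)) -
   (fun x : V => dot x.2 (Cmx J x.1 *m x.1) * dot x.2 (Cmx J x.1 *m x.1) *
      (dot x.1 (Cmx J x.1 *m x.1))^-1)).
  by apply: funext.
rewrite HE diff_val /= qfieldE !dotE /multiplier !fctE.
rewrite (dotC w.1 (_ *m _)) !(dotC w.2 (_ *m _)).
rewrite (dotC (Cmx J z.1 *m z.1) (Cmx J z.1 *m z.2)).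
by rewrite -[LHS]/(2^-1 * _); field.
Qed.

End DiffH.

(** * Critical points *)

Section Critical.
Context {R : realType} {n : nat} (J : 'rV[R]_n) (hJ : forall j, 0 < J 0 j).
Implicit Types (z w : 'cV[R]_n * 'cV[R]_n).

Lemma qfield_neq0 z : cotangent_sphere z -> z.2 != 0 -> qfield J z != 0.
Proof.
move=> /cotangent_sphereP[qq qp]; apply: contraNneq => w0.
have := inertia_qfield hJ z; rewrite w0 mulmx0 scaler0 addr0 => /esym/eqP.
rewrite subr_eq0 => /eqP pE; rewrite -dot_eq0 {1}pE dotZl.
by rewrite qp mulr0.
Qed.

(** Once w = nu p, the equation (JJ + s) w = p - mu q expresses JJ p by q and p,
    so that only JJ q has to be controlled. *)
Lemma principal_plane_of_qfield z nu : cotangent_sphere z -> z.2 != 0 ->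
  qfield J z = nu *: z.2 ->
  JJ J *m z.1 = dot z.1 (JJ J *m z.1) *: z.1
                + (dot z.2 (JJ J *m z.1) / dot z.2 z.2) *: z.2 ->
  exists tau, principal_plane J z tau.
Proof.
move=> zS p0 w Jq.
have nu0 : nu != 0.
  by apply: contraNneq (qfield_neq0 zS p0) => nu0; rewrite w nu0 scale0r.
have Jp := inertia_qfield hJ z; rewrite w -scalemxAr in Jp.
eexists; exists (dot z.1 (JJ J *m z.1)), (dot z.2 (JJ J *m z.1) / dot z.2 z.2).
exists (- (multiplier J z / nu)), (nu^-1 - dot z.1 (JJ J *m z.1)).
split=> //; apply/matrixP => i j; move/matrixP/(_ i j) : Jp.
move: (JJ J *m z.2) => y; rewrite !mxE => Jp.
apply: (mulfI nu0); rewrite mulrDr.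
rewrite -[LHS](addrK (nu * (dot z.1 (JJ J *m z.1) * z.2 i j))) mulrCA Jp.
by field.
Qed.

Lemma critical_principal_plane z : z.2 != 0 -> critical_points J z ->
  exists tau, principal_plane J z tau.
Proof.
move=> p0 [zS [[a b] [ab0 /= crit]]].
have [qq qp] := (cotangent_sphereP z).1 zS.
have q0 := unit_neq0 qq.
have {}crit w : tangent_space z w -> a * (2 * dot z.2 w.2) +
    b * (dot (qfield J z) w.2 - multiplier J z * dot (qfield J z) w.1
    - dot (JJ J *m z.1) w.1 * dot (qfield J z) (qfield J z)) = 0.
  by move=> /crit; rewrite diff_Pfun diff_Hfun.
(* The tangent vector (0, p) shows that dP does not vanish. *)
have b0 : b != 0.
  apply: contraNneq ab0 => b0.
  have := crit (0, z.2); rewrite /tangent_space /= b0 mul0r addr0.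
  rewrite dot0r qp dotC dot0r addr0 => /(_ (conj erefl erefl)) /eqP.
  rewrite !mulf_eq0 dot_eq0 (negPf p0) pnatr_eq0 !orbF => /eqP ->.
  by rewrite xpair_eqE !eqxx.
have w_plane : qfield J z = (dot z.2 (qfield J z) / dot z.2 z.2) *: z.2.
  rewrite -[RHS]add0r -(scale0r z.1) -(dot_q_qfield hJ q0).
  apply: in_plane => // v qv pv.
  have := crit (0, v); rewrite /tangent_space /= dot0r (dotC _ z.2) dot0r qv pv.
  rewrite !dot0r addr0 !mulr0 mul0r !subr0 add0r.
  move=> /(_ (conj erefl erefl)) /eqP.
  by rewrite mulf_eq0 (negPf b0) dotC => /eqP.
apply: (principal_plane_of_qfield zS p0 w_plane); apply: in_plane => // v qv pv.
have := crit (v, 0); rewrite /tangent_space /= !dot0r qv (dotC v) pv addr0.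
have -> : dot (qfield J z) v = 0 by rewrite w_plane dotZl pv mulr0.
rewrite !mulr0 subr0 !add0r mulrN => /(_ (conj erefl erefl)) /eqP.
rewrite oppr_eq0 !mulf_eq0 (negPf b0) dot_eq0 (negPf (qfield_neq0 zS p0)) orbF.
by rewrite dotC => /eqP.
Qed.

Lemma principal_plane_critical z tau : cotangent_sphere z -> z.2 != 0 ->
  principal_plane J z tau -> critical_points J z.
Proof.
move=> zS p0 zP; split=> //; have [qq qp] := (cotangent_sphereP z).1 zS.
have [tau0 wE] := principal_plane_qfield hJ zS p0 zP.
have [c [_ Jq Jp]] := principal_planeP hJ zS p0 zP.
(* The relation 2 dH = dP / tau. *)
exists (- tau^-1, 2); split.
  by rewrite xpair_eqE negb_and pnatr_eq0 orbT.
move=> w [/= qw _].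
rewrite diff_Pfun (diff_Hfun hJ w (unit_neq0 qq)) wE Jq !dotE qw.
have -> : multiplier J z = - (c / tau).
  have := inertia_qfield hJ z; rewrite wE -scalemxAr Jp.
  move=> /(congr1 (dot z.1)); rewrite !dotE qq qp => mE.
  apply/eqP; rewrite -subr_eq0; apply/eqP; move: mE; lra.
have /lt0r_neq0 pp := dot_gt0 p0; field.
by rewrite pp lt0r_neq0.
Qed.

(** At p = 0 the differential of P vanishes. *)
Lemma zero_momentum_critical z : cotangent_sphere z -> z.2 = 0 ->
  critical_points J z.
Proof.
move=> zS p0; split=> //; exists (1, 0); split.
  by rewrite xpair_eqE oner_eq0.
by move=> w _; rewrite diff_Pfun p0 dotC dot0r mul0r !mulr0 addr0.
Qed.

End Critical.

(** * Derivatives of vector-valued curves *)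

Section VectorCurves.
Context {R : realType} {n : nat}.
Implicit Types (x : R -> 'cV[R]_n) (u dx : 'cV[R]_n).

Lemma is_derive_entries x dx (t : R) :
  is_derive t 1 x dx <->
  forall i, is_derive t 1 (fun s => x s i 0) (dx i 0).
Proof.
split=> [[xd <-] i|xd].
  rewrite derive_mx // mxE; apply: derivableP.
  by move/derivable_mxP : xd; apply.
have xd' : derivable x t 1.
  by apply/derivable_mxP => i j; rewrite ord1; exact: ex_derive.
apply: DeriveDef => //; rewrite derive_mx //.
by apply/matrixP => i j; rewrite ord1 mxE derive_val.
Qed.

Lemma is_derive_dot u x dx (t : R) : is_derive t 1 x dx ->
  is_derive t 1 (fun s => dot u (x s)) (dot u dx).
Proof.
move=> /is_derive_entries xd.
have xs := is_derive_sum (fun i => is_deriveZ (u i 0) (xd i)).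
have fE : (fun s => dot u (x s)) = \sum_(i < n) u i 0 \*: (fun s => x s i 0).
  by apply: funext => s; rewrite fct_sumE.
by rewrite fE; exact: xs.
Qed.

Lemma is_derive_comb (f g : R -> R) a b (x y : 'cV[R]_n) (t : R) :
  is_derive t 1 f a -> is_derive t 1 g b ->
  is_derive t 1 (fun s => f s *: x + g s *: y) (a *: x + b *: y).
Proof.
move=> ft gt; apply/is_derive_entries => i.
have fgt := is_deriveD (is_deriveZ (x i 0) ft) (is_deriveZ (y i 0) gt).
have fE : (fun s => (f s *: x + g s *: y) i 0) = x i 0 \*: f + y i 0 \*: g.
  by apply: funext => s; rewrite !mxE mulrC [g s * _]mulrC.
by rewrite fE !mxE mulrC [b * _]mulrC.
Qed.

Lemma is_derive_unique (f : R -> R) a b (t : R) :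
  is_derive t 1 f a -> is_derive t 1 f b -> a = b.
Proof. by move=> [_ <-] [_ <-]. Qed.

End VectorCurves.

(** * The plane of a steady rotation *)

Section Steady.
Context {R : realType} {n : nat} (J : 'rV[R]_n) (hJ : forall j, 0 < J 0 j).
Implicit Types (z : 'cV[R]_n * 'cV[R]_n).

(** Constancy of Omega makes the plane of q and q' independent of time. The
    plane is shown invariant through its orthogonal complement: for v normal to
    it, v . p is constant and equals JJ v . q', so JJ v . q'' = 0, and q'' is a
    nonzero multiple of q. *)
Lemma steady_rotation_principal_plane (q p : R -> 'cV[R]_n) (t : R) :
  is_steady_rotation J q p -> p t != 0 ->
  exists tau, principal_plane J (q t, p t) tau.
Proof.
move=> [sol [Om [Om0 omE]]] p0.
pose w s := qfield J (q s, p s).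
have qq s : dot (q s) (q s) = 1 by have [/cotangent_sphereP[]] := sol s.
have qp s : dot (q s) (p s) = 0 by have [/cotangent_sphereP[]] := sol s.
have q0 s := unit_neq0 (qq s).
have qw s : dot (q s) (w s) = 0.
  exact: (dot_q_qfield hJ (z := (q s, p s)) (q0 s)).
have dq (s : R) : is_derive s 1 q (w s) by have [] := sol s.
have dp (s : R) : is_derive s 1 p (pfield J (q s, p s)) by have [] := sol s.
have OmE s : wedge (q s) (w s) = Om.
  by rewrite -(omE s) /angular_velocity derive1E derive_val.
have w0 s : w s != 0.
  apply: contraNneq Om0 => w0; rewrite -(OmE s) w0.
  by rewrite /wedge trmx0 mulmx0 mul0mx subrr.
have Om_mul s x : Om *m x = dot (w s) x *: q s - dot (q s) x *: w s.
  by rewrite -(OmE s) wedge_mul.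
have Om_q s : Om *m q s = - w s.
  by rewrite (Om_mul s) qq dotC qw scale0r sub0r scale1r.
have Om_w s : Om *m w s = dot (w s) (w s) *: q s.
  by rewrite (Om_mul s) qw scale0r subr0.
have Om_tr x y : dot x (Om *m y) = - dot (Om *m x) y.
  by rewrite dot_mulmx -(OmE t) wedge_tr mulNmx dotNl.
(* Such a v is killed by Omega, and q and w lie in the image of the
   antisymmetric matrix Omega. *)
have normal v : dot (q t) v = 0 -> dot (w t) v = 0 ->
    forall s, dot (q s) v = 0 /\ dot (w s) v = 0.
  move=> qv wv s.
  have Omv : Om *m v = 0 by rewrite (Om_mul t) qv wv !scale0r subrr.
  have ws : dot (w s) v = 0.
    by rewrite -[w s]opprK -Om_q dotNl dotC Om_tr Omv dotC dot0r oppr0 oppr0.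
  split=> //; have /lt0r_neq0 ww := dot_gt0 (w0 s).
  apply: (mulfI ww); rewrite -dotZl -Om_w dotC Om_tr Omv dotC dot0r.
  by rewrite oppr0 mulr0.
(* JJ v is again normal: differentiate v . p, then JJ v . q, along the
   motion. *)
have key v : dot (q t) v = 0 -> dot (w t) v = 0 ->
    dot (JJ J *m v) (q t) = 0 /\ dot (JJ J *m v) (w t) = 0.
  move=> qv wv; have nv := normal v qv wv.
  have vpE s : dot v (p s) = dot (JJ J *m v) (w s).
    have := congr1 (dot v) (inertia_qfield hJ (q s, p s)).
    rewrite /= !dotE -/(w s) !(dotC v) !(nv s).1 !(nv s).2 !mulr0 addr0 subr0.
    by rewrite (dotC _ v) (dotC _ (w s)) (JJ_sym J v) => ->.
  have vpE' s : dot v (p s) = dot (Om *m (JJ J *m v)) (q s).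
    by rewrite vpE -[w s]opprK -Om_q dotNr Om_tr opprK.
  have Jvq s : dot (JJ J *m v) (q s) = 0.
    have d1 := is_derive_dot v (dp s).
    have d2 := is_derive_dot (Om *m (JJ J *m v)) (dq s).
    rewrite -(funext vpE') in d2.
    have := is_derive_unique d1 d2.
    rewrite /pfield dotZr /= (dotC v) (nv s).1 mulr0 -[RHS]opprK -Om_tr Om_w.
    move=> /eqP; rewrite eq_sym oppr_eq0 dotZr mulf_eq0 dot_eq0 (negPf (w0 s)).
    by move/eqP.
  split=> //; have d := is_derive_dot (JJ J *m v) (dq t).
  rewrite (funext Jvq) in d.
  exact: (is_derive_unique d (is_derive_cst _ _ _)).
have Jq : JJ J *m q t = dot (q t) (JJ J *m q t) *: q t
    + (dot (w t) (JJ J *m q t) / dot (w t) (w t)) *: w t.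
  apply: in_plane => // v qv wv.
  by rewrite JJ_sym dotC (key v qv wv).1.
have pE : p t = (dot (w t) (p t) / dot (w t) (w t)) *: w t.
  rewrite -[RHS]add0r -(scale0r (q t)) -(qp t); apply: in_plane => // v qv wv.
  have := congr1 (dot v) (inertia_qfield hJ (q t, p t)).
  rewrite /= !dotE -/(w t) (dotC v (q t)) (dotC v (w t)) qv wv.
  by rewrite JJ_sym (dotC (w t)) (key v qv wv).2 !mulr0 addr0 subr0.
move: (_ / _) pE => k pE.
have k0 : k != 0 by apply: contraNneq p0 => k0; rewrite pE k0 scale0r.
have wE : w t = k^-1 *: p t by rewrite pE scalerA mulVf // scale1r.
apply: (principal_plane_of_qfield hJ (z := (q t, p t)) _ p0 wE).
  by case: (sol t).
rewrite /= [LHS]Jq; congr (_ + _).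
by rewrite wE !dotE scalerA; congr (_ *: _); field; rewrite dot_eq0 p0 k0.
Qed.

End Steady.

(** * Uniform rotation in a principal plane *)

Section Rotation.
Context {R : realType} {n : nat} (J : 'rV[R]_n) (hJ : forall j, 0 < J 0 j).
Implicit Types (z : 'cV[R]_n * 'cV[R]_n).

(** A rotation in the plane of [z.1] and [z.2] when [c] and [s * enorm z.2] are
    the cosine and sine of an angle; this scaling of [s] spares square roots. *)
Definition rotate z (c s : R) : 'cV[R]_n * 'cV[R]_n :=
  (c *: z.1 + s *: z.2, c *: z.2 - (s * dot z.2 z.2) *: z.1).

Lemma rotate_cotangent z c s : cotangent_sphere z ->
  c ^+ 2 + s ^+ 2 * dot z.2 z.2 = 1 ->
  cotangent_sphere (rotate z c s) /\
  dot (rotate z c s).2 (rotate z c s).2 = dot z.2 z.2.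
Proof.
move=> /cotangent_sphereP[qq qp] cs; have pq : dot z.2 z.1 = 0 by rewrite dotC.
split; first apply/cotangent_sphereP; rewrite /= ?dotE ?qq ?qp ?pq.
- by split; [rewrite -[RHS]cs|]; ring.
- by rewrite -[RHS]mul1r -[X in _ = X * _]cs; ring.
Qed.

Lemma rotate_principal_plane z c s tau :
  c ^+ 2 + s ^+ 2 * dot z.2 z.2 = 1 ->
  principal_plane J z tau -> principal_plane J (rotate z c s) tau.
Proof.
case: z => q p /= cs [a [b [c0 [d [/= Jq Jp <-]]]]]; rewrite /rotate /=.
set r := dot p p in cs *.
exists ((c * a + s * c0) * c + (c * b + s * d) * (s * r)).
exists ((c * b + s * d) * c - (c * a + s * c0) * s).
exists ((c * c0 - s * r * a) * c + (c * d - s * r * b) * (s * r)).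
exists ((c * d - s * r * b) * c - (c * c0 - s * r * a) * s).
(* The entries are polynomial identities once multiplied by c^2 + s^2 r = 1. *)
split; rewrite /= ?mulmxBr ?mulmxDr -?scalemxAr ?Jq ?Jp.
- apply/matrixP => i j; rewrite !mxE.
  transitivity ((c ^+ 2 + s ^+ 2 * r) * ((c * a + s * c0) * q i j +
    (c * b + s * d) * p i j)); last by ring.
  by rewrite cs; ring.
- apply/matrixP => i j; rewrite !mxE.
  transitivity ((c ^+ 2 + s ^+ 2 * r) * ((c * c0 - s * r * a) * q i j +
    (c * d - s * r * b) * p i j)); last by ring.
  by rewrite cs; ring.
- transitivity ((c ^+ 2 + s ^+ 2 * r) * (a + d)); last by rewrite cs mul1r.
  by ring.
Qed.

(** The angle grows at speed |p| / tau, because the velocity on a principal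
    plane is p / tau and rotation preserves both the plane and the trace. *)
Lemma principal_plane_steady z tau : cotangent_sphere z -> z.2 != 0 ->
  principal_plane J z tau -> steady_rotation_points J z.
Proof.
move=> zS p0 zP; have [tau0 _] := principal_plane_qfield hJ zS p0 zP.
have [qq qp] := (cotangent_sphereP z).1 zS.
have r2 : 0 < dot z.2 z.2 by exact: dot_gt0.
set r := enorm z.2.
have rE : r ^+ 2 = dot z.2 z.2 by rewrite enorm_sqr.
have r0 : 0 < r by rewrite sqrtr_gt0.
pose th := tau^-1 * r.
pose c t := cos (th * t); pose s t := r^-1 * sin (th * t).
have cs t : c t ^+ 2 + s t ^+ 2 * dot z.2 z.2 = 1.
  rewrite -rE exprMn mulrAC -exprMn mulVf ?gt_eqF // expr1n mul1r.
  exact: cos2Dsin2.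
pose Z t := rotate z (c t) (s t).
have ZS t : cotangent_sphere (Z t) by have [] := rotate_cotangent zS (cs t).
have Zp t : dot (Z t).2 (Z t).2 = dot z.2 z.2.
  by have [] := rotate_cotangent zS (cs t).
have Zp0 t : (Z t).2 != 0 by rewrite -dot_eq0 Zp dot_eq0.
have ZP t := rotate_principal_plane (cs t) zP.
have Zq t : qfield J (Z t) = tau^-1 *: (Z t).2.
  by have [] := principal_plane_qfield hJ (ZS t) (Zp0 t) (ZP t).
have dth (t : R) : is_derive t 1 (fun u => th * u) th.
  exact: is_derive_eq (is_deriveZ th (is_derive_id t 1)) (mulr1 th).
have dc (t : R) : is_derive t 1 c (- (tau^-1 * dot z.2 z.2) * s t).
  apply: (is_derive_eq (is_derive1_comp (is_derive_cos (th * t)) (dth t))).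
  by rewrite -rE /s /th; field; rewrite !gt_eqF.
have dsin (t : R) : is_derive t 1 (fun u => sin (th * u)) (c t * th).
  exact: (is_derive1_comp (is_derive_sin (th * t)) (dth t)).
have ds (t : R) : is_derive t 1 s (tau^-1 * c t).
  apply: (is_derive_eq (is_deriveZ r^-1 (dsin t))).
  by rewrite -[LHS]/(_ * _) /th; field; rewrite !gt_eqF.
have dq (t : R) : is_derive t 1 (fun u => (Z u).1) (tau^-1 *: (Z t).2).
  apply: (is_derive_eq (is_derive_comb z.1 z.2 (dc t) (ds t))).
  by apply/matrixP => i j; rewrite !mxE; ring.
exists (fun t => (Z t).1), (fun t => (Z t).2); split; last first.
  exists 0; rewrite /Z /rotate /c /s mulr0 cos0 sin0 mulr0 mul0r !scale1r.
  by rewrite !scale0r addr0 subr0; case: (z).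
have dp (t : R) : is_derive t 1 (fun u => (Z u).2) (pfield J (Z t)).
  have dsN := is_deriveZ (- dot z.2 z.2) (ds t).
  have ZE : (fun u => (Z u).2) =
      (fun u => c u *: z.2 + (- dot z.2 z.2 \*: s) u *: z.1).
    by apply: funext => u; rewrite /= -scaleNr -mulrN mulrC.
  rewrite ZE; apply: (is_derive_eq (is_derive_comb z.2 z.1 (dc t) dsN)).
  rewrite /pfield -dot_p_qfield Zq dotZr Zp.
  by apply/matrixP => i j; rewrite !mxE -[X in _ + X * _]/(_ * _); ring.
split.
  by move=> t; rewrite -surjective_pairing; split=> //; rewrite Zq.
exists (wedge z.1 (tau^-1 *: z.2)); split.
  apply: wedge_neq0 => //; first by rewrite dotZr qp mulr0.
  by rewrite scaler_eq0 invr_eq0 gt_eqF.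
move=> t; rewrite /angular_velocity derive1E derive_val.
apply/matrixP => i j.
by rewrite !wedge_mxE -[RHS]mul1r -[X in _ = X * _](cs t) !mxE; ring.
Qed.

End Rotation.

(** * Critical values *)

Section CriticalValues.
Context {R : realType} {n : nat} (J : 'rV[R]_n) (hJ : forall j, 0 < J 0 j).

Definition axis_point (i j : 'I_n) (r : R) : 'cV[R]_n * 'cV[R]_n :=
  (delta_mx i 0, r *: delta_mx j 0).

Lemma dot_delta (i : 'I_n) (x : 'cV[R]_n) : dot (delta_mx i 0) x = x i 0.
Proof.
rewrite /dot (bigD1 i) //= big1 => [|k ki]; rewrite !mxE ?eqxx ?mul1r ?addr0 //.
by rewrite (negPf ki) mul0r.
Qed.

Lemma JJ_delta i : JJ J *m delta_mx i 0 = J 0 i *: delta_mx i 0 :> 'cV[R]_n.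
Proof.
apply/matrixP => k l; rewrite ord1 JJ_mxE !mxE.
by case: eqP => [->|]; rewrite ?mulr0.
Qed.

Lemma axis_point_cotangent i j r :
  i != j -> cotangent_sphere (axis_point i j r).
Proof.
move=> ij; apply/cotangent_sphereP.
by rewrite /= dotZr !dot_delta !mxE !eqxx (negPf ij) mulr0.
Qed.

Lemma axis_point_principal_plane i j r :
  principal_plane J (axis_point i j r) (J 0 i + J 0 j).
Proof.
exists (J 0 i), 0, 0, (J 0 j); split=> //=; rewrite scale0r ?addr0 ?add0r.
  exact: JJ_delta.
by rewrite -scalemxAr JJ_delta scalerA mulrC -scalerA.
Qed.

Lemma axis_point_P i j r : Pfun (axis_point i j r) = r ^+ 2.
Proof.
by rewrite /Pfun enorm_sqr /= dotZl dotZr dot_delta mxE !eqxx mulr1.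
Qed.

Lemma Pfun_Hfun_0 (z : 'cV[R]_n * 'cV[R]_n) :
  z.2 = 0 -> Pfun z = 0 /\ Hfun J z = 0.
Proof.
move=> p0; rewrite /Pfun enorm_sqr p0 dot0r; split=> //.
have /eqP := dot_p_qfield J z; rewrite p0 dotC dot0r eq_sym mulf_eq0.
by rewrite pnatr_eq0 => /eqP.
Qed.

Lemma critical_values_rays : (2 <= n)%N ->
  critical_values J = [set PH | exists i j : 'I_n, (i < j)%N /\ ray J i j PH].
Proof.
move=> hn; apply/seteqP; split=> [_ [z zc <-]|[P H] [i [j [ij [/= P0 H0 PE]]]]].
  have [p0|p0] := eqVneq z.2 0.
    have [-> ->] := Pfun_Hfun_0 p0.
    exists (Ordinal (ltnW hn)), (Ordinal hn); split=> //; split=> //=.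
    by rewrite mulr0.
  have [tau zP] := critical_principal_plane hJ p0 zc.
  have [tau0 PE] := principal_plane_PH hJ zc.1 p0 zP.
  have [i [j [ij tauE]]] := principal_plane_trace zc.1 p0 zP.
  exists i, j; split=> //; split=> /=.
  - exact: sqr_ge0.
  - rewrite -(pmulr_rge0 _ (mulr_gt0 (ltr0Sn R 1) tau0)) -PE; exact: sqr_ge0.
  - by rewrite PE tauE.
have ij' : i != j by apply: contraTneq ij => ->; rewrite ltnn.
pose z := axis_point i j (Num.sqrt P).
have zS : cotangent_sphere z by exact: axis_point_cotangent.
have zPE : Pfun z = P by rewrite axis_point_P sqr_sqrtr.
have tau0 : 0 < 2 * (J 0 i + J 0 j) by rewrite mulr_gt0 ?addr_gt0.
have [p0|p0] := eqVneq z.2 0.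
  exists z; first exact: zero_momentum_critical.
  have [Pz Hz] := Pfun_Hfun_0 p0; rewrite zPE Hz; congr (_, _).
  by apply: (mulfI (lt0r_neq0 tau0)); rewrite -PE -zPE Pz mulr0.
have zP := axis_point_principal_plane i j (Num.sqrt P).
exists z; first exact: principal_plane_critical zP.
have [_ PH] := principal_plane_PH hJ zS p0 zP.
by rewrite zPE; congr (_, _); apply: (mulfI (lt0r_neq0 tau0)); rewrite -PH -PE.
Qed.

End CriticalValues.

Theorem proposition3p10 (R : realType) (n : nat) (hn : (2 <= n)%N)
    (J : 'rV[R]_n) (hJ : forall j : 'I_n, 0 < J 0 j) :
  critical_points J `&` [set z : 'cV[R]_n * 'cV[R]_n | z.2 != 0]
    = steady_rotation_points J `&` [set z : 'cV[R]_n * 'cV[R]_n | z.2 != 0]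
  /\
  critical_values J
    = [set PH | exists i j : 'I_n, (i < j)%N /\ ray J i j PH].
Proof.
split; last exact: critical_values_rays.
apply/seteqP; split=> z [zz p0]; split=> //=.
  have [tau zP] := critical_principal_plane hJ p0 zz.
  exact: principal_plane_steady zz.1 p0 zP.
have [q [p [steady [t zE]]]] := zz; move: p0; rewrite zE /= => p0.
have [tau zP] := steady_rotation_principal_plane hJ steady p0.
by apply: principal_plane_critical zP => //; case: (steady.1 t).
Qed.
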